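(* Let $X$ be a $k$-regular connected graph and $S$ a nonempty set of marked vertices, $\overline S=V\setminus S$. Let $A_{\overline S}=\sum_r\lambda_rG_r$ be the spectral decomposition of $X\setminus S$. Then, entrywise, $$\widehat M[\overline S,\overline S]\ge\frac12\sum_r\frac{1}{k^2-\lambda_r^2}\left((k^2-2\lambda_r^2)I+k\lambda_r^2\Delta(\overline S,\overline S)^\dagger\right)G_r^{\circ2}.$$ Moreover, equality holds if and only if $X\setminus S$ is a disjoint union of edges and isolated vertices, in which case, for $u,v\in\overline S$: $\widehat M_{u,v}=\frac{k+2}{4(k+1)}$ if $u$ and $v$ lie in the same edge component of $X\setminus S$ (including $u=v$), $\widehat M_{u,u}=\frac12$ if $u$ is an isolated vertex of $X\setminus S$, and $\widehat M_{u,v}=0$ otherwise.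
   Context: Walk: arcs are ordered pairs $(u,v)$ of adjacent vertices; $R$ the arc-reversal matrix; $D_t$ the tail incidence matrix ($(D_t)_{x,(u,v)}=1$ iff $x=u$); $O_S$ the identity with $[S,S]$ block zeroed; $U=R(\frac2kD_t^TO_SD_t-I)$. Average vertex mixing matrix: $\widehat M_{u,v}=\lim_{T\to\infty}\frac1T\sum_{t=0}^{T-1}\sum_{w\sim u}|(U^tx_v)_{(u,w)}|^2$, $x_v=k^{-1/2}D_t^Te_v$. $A_{\overline S}=A[\overline S,\overline S]$. $\Delta(\overline S,\overline S)$ is the diagonal matrix of vertex degrees in $X\setminus S$; $\dagger$ denotes the pseudo-inverse; $\circ$ is the Schur product, $N^{\circ2}=N\circ N$. *)

(* Defs.v *)
From HB Require Import structures.
From mathcomp Require Import all_boot all_order all_algebra.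
From mathcomp Require Import all_classical all_reals all_analysis.

Set Implicit Arguments.
Unset Strict Implicit.
Unset Printing Implicit Defensive.

Import Order.TTheory GRing.Theory Num.Theory.
Import numFieldNormedType.Exports.

Local Open Scope ring_scope.

(* Library matrices are indexed by ordinals; a matrix with rows indexed by I
   and columns by J is a #|I| x #|J| matrix, read through enum_val/enum_rank. *)
Definition fmx (R : Type) (I J : finType) (f : I -> J -> R) :
  'M[R]_(#|I|, #|J|) :=
  \matrix_(i, j) f (enum_val i) (enum_val j).

Definition entry (R : Type) (I J : finType) (A : 'M[R]_(#|I|, #|J|))
  (x : I) (y : J) : R := A (enum_rank x) (enum_rank y).

Lemma entry_fmx (R : Type) (I J : finType) (f : I -> J -> R) x y :
  entry (fmx f) x y = f x y.
Proof. by rewrite /entry mxE !enum_rankK. Qed.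

Section MatrixTheory.
Variable R : realType.

Definition schur m n (A B : 'M[R]_(m, n)) : 'M[R]_(m, n) :=
  map2_mx *%R A B.

Definition moore_penrose m n (A : 'M[R]_(m, n)) (B : 'M[R]_(n, m)) : Prop :=
  [/\ A *m B *m A = A, B *m A *m B = B,
      (A *m B)^T = A *m B & (B *m A)^T = B *m A].

Definition pinv m n (A : 'M[R]_(m, n)) : 'M[R]_(n, m) :=
  xget 0 (moore_penrose A).

Lemma gram_unit m n (F : 'M[R]_(m, n)) : row_free F -> F *m F^T \in unitmx.
Proof.
move=> freeF; rewrite -row_free_unit -kermx_eq0; apply/rowV0P => x.
move/sub_kermxP => xFF0.
have: (x *m F) *m (x *m F)^T = 0.
  by rewrite trmx_mul mulmxA -(mulmxA x) xFF0 mul0mx.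
move=> /matrixP /(_ 0 0); rewrite !mxE => /eqP.
rewrite psumr_eq0 => [/allP xF0|j _]; last by rewrite !mxE -expr2 sqr_ge0.
apply: (row_free_inj freeF); rewrite mul0mx; apply/rowP => j; rewrite [RHS]mxE.
have /xF0 := mem_index_enum j.
by rewrite [(_^T) _ _]mxE -expr2 sqrf_eq0 => /eqP.
Qed.

Lemma moore_penrose_unique m n (A : 'M[R]_(m, n)) (B C : 'M[R]_(n, m)) :
  moore_penrose A B -> moore_penrose A C -> B = C.
Proof.
move=> [ABA BAB sAB sBA] [ACA CAC sAC sCA].
have AB_AC : A *m B = A *m C.
  rewrite -sAB -{1}ACA -(mulmxA (A *m C)) trmx_mul sAB sAC mulmxA.
  by rewrite ABA.
have BA_CA : B *m A = C *m A.
  rewrite -sBA -{1}ACA -(mulmxA A) mulmxA trmx_mul sBA sCA.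
  by rewrite -!mulmxA (mulmxA A) ABA.
by rewrite -BAB BA_CA -mulmxA AB_AC mulmxA CAC.
Qed.

Lemma pinvP m n (A : 'M[R]_(m, n)) : moore_penrose A (pinv A).
Proof.
rewrite /pinv; case: xgetP => // none; exfalso.
have [p [C [F [freeC freeF defA]]]] : exists p (C : 'M[R]_(m, p))
    (F : 'M[R]_(p, n)), [/\ row_free C^T, row_free F & A = C *m F].
  exists (\rank A), (col_base A), (row_base A).
  split; [|exact: row_base_free|by rewrite mulmx_base].
  by rewrite /row_free mxrank_tr -/(row_full _) col_base_full.
have uF : F *m F^T \in unitmx by exact: gram_unit.
have uC : C^T *m C \in unitmx by rewrite -{2}[C]trmxK; exact: gram_unit.
pose X := invmx (F *m F^T); pose Y := invmx (C^T *m C).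
have FX : F *m F^T *m X = 1%:M by rewrite mulmxV.
have YC : Y *m (C^T *m C) = 1%:M by rewrite mulVmx.
have sX : X^T = X by rewrite trmx_inv trmx_mul trmxK.
have sY : Y^T = Y by rewrite trmx_inv trmx_mul trmxK.
pose B := F^T *m X *m Y *m C^T.
have AB : A *m B = C *m Y *m C^T.
  by rewrite defA /B !mulmxA -(mulmxA C F) -(mulmxA C (F *m F^T)) FX mulmx1.
have BA : B *m A = F^T *m X *m F.
  by rewrite defA /B -!mulmxA (mulmxA C^T) (mulmxA Y) YC mul1mx.
apply: (none B); split.
- by rewrite AB defA -!mulmxA (mulmxA C^T) (mulmxA Y) YC mul1mx.
- by rewrite BA /B !mulmxA -(mulmxA (F^T *m X) F) -(mulmxA (F^T *m X)) FX mulmx1.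
- by rewrite AB !trmx_mul trmxK sY mulmxA.
- by rewrite BA !trmx_mul trmxK sX mulmxA.
Qed.

Definition spectral_decomposition n (A : 'M[R]_n) d
  (lam : 'I_d -> R) (G : 'I_d -> 'M[R]_n) : Prop :=
  [/\ injective lam,
      forall r, eigenvalue A (lam r),
      (* G r is the orthogonal projection onto the lam r-eigenspace *)
      forall r, [/\ (G r)^T = G r, G r *m G r = G r
                  & (G r :=: eigenspace A (lam r))%MS],
      \sum_r G r = 1%:M
    & A = \sum_r lam r *: G r].

End MatrixTheory.

Section Graph.
Variables (V : finType) (e : rel V).

Definition simple_graph : Prop := symmetric e /\ irreflexive e.

Definition connected_graph : Prop := forall x y, connect e x y.

Definition vdegree (x : V) : nat := #|[pred y | e x y]|.

Definition regular_graph (k : nat) : Prop := forall x, vdegree x = k.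

Definition graph_component (x : V) : {set V} := [set y | connect e x y]%SET.

Definition isolated_vertex (x : V) : Prop := vdegree x = 0%N.

Definition edge_component (C : {set V}) : Prop :=
  exists x y, [/\ e x y, C = graph_component x & C = [set x; y]%SET].

Definition union_of_edges_and_isolated : Prop :=
  forall x, edge_component (graph_component x) \/ isolated_vertex x.

Definition same_edge_component (x y : V) : Prop :=
  edge_component (graph_component x) /\ graph_component x = graph_component y.

End Graph.

Section InducedSubgraph.
Variables (V : finType) (e : rel V) (S : {set V}).

Definition unmarked : finType := {x : V | x \notin S}.

(* The graph X \ S. *)
Definition delete : rel unmarked := fun x y => e (val x) (val y).

End InducedSubgraph.

Section Walk.
Variables (R : realType) (V : finType) (e : rel V) (k : nat) (S : {set V}).

Definition graph_arc : finType := {p : V * V | e p.1 p.2}.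
Definition arc_tail (a : graph_arc) : V := (val a).1.
Definition arc_head (a : graph_arc) : V := (val a).2.

Definition adjacency : 'M[R]_#|V| := fmx (fun x y => (e x y)%:R).

Definition arc_reversal : 'M[R]_#|graph_arc| :=
  fmx (fun a b => ((arc_tail a == arc_head b) && (arc_head a == arc_tail b))%:R).

Definition tail_incidence : 'M[R]_(#|V|, #|graph_arc|) :=
  fmx (fun x a => (x == arc_tail a)%:R).

Definition unmarked_id : 'M[R]_#|V| :=
  fmx (fun x y => if (x \in S) && (y \in S) then 0 else (x == y)%:R).

Definition transition : 'M[R]_#|graph_arc| :=
  arc_reversal *m
    ((2 / k%:R) *: (tail_incidence^T *m unmarked_id *m tail_incidence) - 1%:M).

Definition initial_state (v : V) : 'cV[R]_#|graph_arc| :=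
  (Num.sqrt k%:R)^-1 *: (tail_incidence^T *m delta_mx (enum_rank v) 0).

Definition amplitude (t : nat) (v : V) (a : graph_arc) : R :=
  (transition ^+ t *m initial_state v) (enum_rank a) 0.

(* The arcs (u, w) with w ~ u are the arcs with tail u.  The amplitudes are
   real because the transition matrix and the initial states are. *)
Definition avg_mixing : 'M[R]_#|V| :=
  fmx (fun u v => limn (fun T : nat =>
    T%:R^-1 * \sum_(0 <= t < T) \sum_(a : graph_arc | arc_tail a == u)
      `|amplitude t v a| ^+ 2)).

(* The block N[V \ S, V \ S]. *)
Definition unmarked_block (N : 'M[R]_#|V|) : 'M[R]_#|unmarked S| :=
  fmx (fun x y : unmarked S => entry N (val x) (val y)).

Definition degree_matrix : 'M[R]_#|unmarked S| :=
  fmx (fun x y : unmarked S =>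
    if x == y then (vdegree (delete e (S := S)) x)%:R else 0).

Definition lower_bound d (lam : 'I_d -> R) (G : 'I_d -> 'M[R]_#|unmarked S|) :
  'M[R]_#|unmarked S| :=
  (1 / 2) *: \sum_(r < d) (1 / (k%:R ^+ 2 - lam r ^+ 2)) *:
    (((k%:R ^+ 2 - 2 * lam r ^+ 2) *: 1%:M
      + (k%:R * lam r ^+ 2) *: pinv degree_matrix) *m schur (G r) (G r)).

End Walk.

(* Main.v *)
(* Let f_r be the column v of G_r, extended by 0 to S, and put
   phi_r(t) = U^t (f_r o tail).  On the span of f_r o tail and f_r o head the
   walk acts as a rotation by the angle theta_r with cos theta_r = lambda_r / k:
   phi_r(t+2) = 2 (lambda_r / k) phi_r(t+1) - phi_r(t).  Here |lambda_r| < k,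
   because an eigenvector for an eigenvalue of modulus >= k would have constant
   absolute value on the connected graph X while vanishing on S.  Distinct angles are orthogonal
   in time average, and the average of phi_r(t)^2 is determined by the conserved
   quadratic form of the recurrence; hence
     M_uv = sum_r (k sum_(w ~ u) G_r(w,v)^2 + (k^2 - 2 lambda_r^2) G_r(u,v)^2)
                  / (2 (k^2 - lambda_r^2)).
   As sum_(w ~ u) G_r(w,v) = lambda_r G_r(u,v), the bound is Cauchy-Schwarz, and
   the gap is a positive combination of the variances of G_r(.,v) over the
   neighbours of u.  If they all vanish then summing over r shows that two
   neighbours w, w' of u satisfy I(w,v) = I(w',v) for all v, so w = w'. *)

Require Import Defs.
From HB Require Import structures.
From mathcomp Require Import all_boot all_order all_algebra ring lra.
From mathcomp Require Import all_classical all_reals all_analysis.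

Set Implicit Arguments.
Unset Strict Implicit.
Unset Printing Implicit Defensive.

Import Order.TTheory GRing.Theory Num.Theory.
Import numFieldNormedType.Exports.

Local Open Scope ring_scope.

(** * Cesàro means of sequences obeying a cosine recurrence *)

Section TimeAverage.
Variable R : realType.
Implicit Types (a b u w : nat -> R) (c l : R).

Definition time_average u (T : nat) : R := T%:R^-1 * \sum_(0 <= t < T) u t.

Local Notation mean_to u l := (time_average u @ \oo --> l)%classic.

Lemma invn_cvg0 : ((fun n : nat => (n%:R : R)^-1) @ \oo --> (0 : R))%classic.
Proof. by rewrite -cvg_shiftS; exact: cvg_harmonic. Qed.

Lemma mean_to_cst c : mean_to (fun=> c) c.
Proof.
(* The shift discards [T = 0], where [0^-1 = 0] makes the average 0 instead of [c]. *)
rewrite -cvg_shiftS; apply: cvg_near_cst.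
near=> n; rewrite /= /time_average big_const_nat iter_addr_0 subn0.
by rewrite -[c *+ _]mulr_natl mulrA mulVf ?mul1r // pnatr_eq0.
Unshelve. all: by end_near. Qed.

Lemma mean_toD u w l m : mean_to u l -> mean_to w m ->
  mean_to (fun t => u t + w t) (l + m).
Proof.
move=> ul wm; rewrite (_ : time_average _ = time_average u \+ time_average w).
  exact: cvgD.
by apply/funext => T; rewrite /time_average big_split /= mulrDr.
Qed.

Lemma mean_toZ c u l : mean_to u l -> mean_to (fun t => c * u t) (c * l).
Proof.
move=> ul.
rewrite (_ : time_average _ = (fun T => c * time_average u T)).
  exact: cvgMl_tmp.
by apply/funext => T; rewrite /time_average -mulr_sumr mulrCA.
Qed.

Lemma mean_to_sum (I : Type) (s : seq I) (P : pred I) (u : I -> nat -> R)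
    (l : I -> R) : (forall i, P i -> mean_to (u i) (l i)) ->
  mean_to (fun t => \sum_(i <- s | P i) u i t) (\sum_(i <- s | P i) l i).
Proof.
move=> ul; elim: s => [|i s IHs].
  by under eq_fun do rewrite big_nil; rewrite big_nil; exact: mean_to_cst.
under eq_fun do rewrite big_cons; rewrite big_cons.
case: ifP => [Pi|_]; last exact: IHs.
by apply: mean_toD => //; exact: ul.
Qed.

(** The partial sum collapses to [w T - w 0], which is bounded by [2C], so the average is O(1/T). *)
Lemma mean_to_telescope u w C : (forall t, `|w t| <= C) ->
  (forall t, u t = w t.+1 - w t) -> mean_to u 0.
Proof.
move=> wC uw.
have bnd T : `|time_average u T| <= (C + C) * T%:R^-1.
  rewrite /time_average normrM mulrC [X in _ * X]ger0_norm ?invr_ge0 ?ler0n //.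
  apply: ler_wpM2r; first by rewrite invr_ge0 ler0n.
  rewrite (eq_bigr (fun t => w t.+1 - w t)) => [|t _]; last exact: uw.
  rewrite telescope_sumr //; apply: (le_trans (ler_normB _ _)).
  exact: lerD.
have lim0 : ((fun T : nat => (C + C) * (T%:R : R)^-1) @ \oo --> (0 : R))%classic.
  by rewrite -(mulr0 (C + C)); apply: cvgMl_tmp; exact: invn_cvg0.
apply/norm_cvg0P; apply: (squeeze_cvgr _ (cvg_cst 0) lim0).
by near=> T; rewrite normr_ge0 bnd.
Unshelve. all: by end_near. Qed.

(* A sequence t |-> alpha cos (t theta) + beta sin (t theta), with
   c = cos theta. *)
Definition oscillation c a := forall t, a t.+2 = 2 * c * a t.+1 - a t.

(** On consecutive values of alpha cos(t theta) + beta sin(t theta) this is (alpha^2 + beta^2)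
    sin^2(theta), the invariant of the recurrence. *)
Definition energy c (x y : R) := x ^+ 2 + y ^+ 2 - 2 * c * x * y.

Lemma energy_oscillation c a t : oscillation c a ->
  energy c (a t) (a t.+1) = energy c (a 0) (a 1).
Proof.
by move=> osc; elim: t => // t <-; rewrite /energy osc; ring.
Qed.

(** Completing the square, the energy is (y - c x)^2 + (1 - c^2) x^2, so its conservation bounds
    x^2. *)
Lemma oscillation_bounded c a : c ^+ 2 < 1 -> oscillation c a ->
  exists C, forall t, `|a t| <= C.
Proof.
move=> c1 osc; have c1' : 0 < 1 - c ^+ 2 by rewrite subr_gt0.
exists (1 + energy c (a 0) (a 1) / (1 - c ^+ 2)) => t.
have : `|a t| <= 1 + a t ^+ 2 by rewrite ler_norml; apply/andP; split; nra.
move=> /le_trans; apply; rewrite lerD2l ler_pdivlMr //.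
rewrite -(energy_oscillation t osc).
rewrite /energy; have := sqr_ge0 (a t.+1 - c * a t); nra.
Qed.

Lemma mean_oscillation_sqr c a : c ^+ 2 < 1 -> oscillation c a ->
  mean_to (fun t => a t ^+ 2) (energy c (a 0) (a 1) / (2 * (1 - c ^+ 2))).
Proof.
move=> c1 osc; have c1' : 1 - c ^+ 2 != 0 by rewrite gt_eqF // subr_gt0.
have [C aC] := oscillation_bounded c1 osc.
set E := energy _ _ _; set K := 2 * (1 - c ^+ 2).
have K0 : K != 0 by rewrite mulf_neq0 // pnatr_eq0.
(* This is c a_t a_(t-1) - a_t^2, with a_(t-1) extrapolated backwards by the recurrence so that t =
   0 is no exception. Its increment is the deviation of [K * a t ^+ 2] from the energy, so that
   deviation averages to 0. *)
pose z t := - a t ^+ 2 + c * a t * (2 * c * a t - a t.+1).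
have tel t : K * a t ^+ 2 - E = z t.+1 - z t.
  by rewrite /E -(energy_oscillation t osc) /K /z /energy osc; ring.
have C0 : 0 <= C := le_trans (normr_ge0 _) (aC 0).
have zC t : `|z t| <= C ^+ 2 + `|c| * C * (2 * `|c| * C + C).
  apply: (le_trans (ler_normD _ _)); rewrite normrN normrX.
  apply: lerD; first by rewrite lerXn2r.
  rewrite !normrM; apply: ler_pM; rewrite ?mulr_ge0 //.
    by rewrite ler_wpM2l.
  apply: (le_trans (ler_normB _ _)); rewrite !normrM normr_nat.
  by apply: lerD => //; rewrite ler_wpM2l // mulr_ge0.
have := @mean_toZ K^-1 _ _ (mean_toD (mean_to_telescope zC tel) (@mean_to_cst E)).
rewrite add0r mulrC; under eq_fun do rewrite subrK mulKf //.
by [].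
Qed.

Lemma mean_oscillation_mul c c' a b : c ^+ 2 < 1 -> c' ^+ 2 < 1 -> c != c' ->
  oscillation c a -> oscillation c' b -> mean_to (fun t => a t * b t) 0.
Proof.
move=> c1 c1' cc' osca oscb.
have [C aC] := oscillation_bounded c1 osca.
have [D bD] := oscillation_bounded c1' oscb.
have C0 : 0 <= C := le_trans (normr_ge0 _) (aC 0).
have D0 : 0 <= D := le_trans (normr_ge0 _) (bD 0).
set K := 2 * (c - c').
have K0 : K != 0 by rewrite mulf_neq0 ?pnatr_eq0 // subr_eq0.
(* The Wronskian a_t b_(t-1) - a_(t-1) b_t, with a_(t-1) and b_(t-1)
   extrapolated backwards by the recurrence. *)
pose w t := a t.+1 * b t - a t * b t.+1 - K * (a t * b t).
have tel t : K * (a t * b t) = w t.+1 - w t.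
  by rewrite /w /K osca oscb; ring.
have abC s t : `|a s * b t| <= C * D by rewrite normrM ler_pM.
have wC t : `|w t| <= C * D + C * D + `|K| * (C * D).
  apply: (le_trans (ler_normB _ _)); apply: lerD.
    by apply: (le_trans (ler_normB _ _)); apply: lerD.
  by rewrite normrM ler_wpM2l.
have := @mean_toZ K^-1 _ _ (mean_to_telescope wC tel); rewrite mulr0.
by under eq_fun do rewrite mulKf //.
Qed.

Lemma mean_sum_oscillation_sqr d (c : 'I_d -> R) (a : 'I_d -> nat -> R) :
    injective c -> (forall r, c r ^+ 2 < 1) ->
    (forall r, oscillation (c r) (a r)) ->
  mean_to (fun t => (\sum_r a r t) ^+ 2)
    (\sum_r energy (c r) (a r 0%N) (a r 1%N) / (2 * (1 - c r ^+ 2))).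
Proof.
move=> injc c1 osc.
pose E r := energy (c r) (a r 0%N) (a r 1%N) / (2 * (1 - c r ^+ 2)).
(* The limit is put in the shape of the expanded square, so that limits can be taken term by term;
   only the diagonal ones are nonzero. *)
have EE : \sum_r E r = \sum_r \sum_q if q == r then E r else 0.
  by apply: eq_bigr => r _; rewrite -big_mkcond big_pred1_eq.
rewrite [\sum_r _]EE; under eq_fun => t do rewrite expr2 mulr_suml.
apply: mean_to_sum => r _.
under eq_fun => t do rewrite mulr_sumr; apply: mean_to_sum => q _.
case: eqVneq => [->|qr].
  under eq_fun => t do rewrite -expr2.
  exact: mean_oscillation_sqr (c1 r) (osc r).
by apply: (mean_oscillation_mul (c1 r) (c1 q)) => //; rewrite inj_eq // eq_sym.
Qed.

End TimeAverage.

(** * Reindexing of finite sums *)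

Lemma sum_val (R : nmodType) (T : finType) (P : pred T) (sT : subFinType P)
    (Q : pred T) (F : T -> R) : subpred Q P ->
  \sum_(x : sT | Q (val x)) F (val x) = \sum_(x | Q x) F x.
Proof.
move=> QP; rewrite [RHS](reindex_omap (val : sT -> T) insub) => [|x Qx].
  by apply: eq_bigl => x; rewrite valK eqxx andbT.
by rewrite insubT ?QP //= => Px; rewrite SubK.
Qed.

Lemma sum_enum_rank (R : nmodType) (I : finType) (F : 'I_#|I| -> R) :
  \sum_i F i = \sum_x F (enum_rank x).
Proof. by rewrite (reindex enum_rank) //; exact/onW_bij/enum_rank_bij. Qed.

Lemma mulmx_enum_rank (R : pzSemiRingType) (I J : finType) n
    (A : 'M[R]_(#|I|, #|J|)) (B : 'M[R]_(#|J|, n)) x j :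
  (A *m B) (enum_rank x) j = \sum_y entry A x y * B (enum_rank y) j.
Proof. by rewrite mxE sum_enum_rank. Qed.

Lemma sum_pred1_natr (R : pzSemiRingType) (I : finType) (x : I) (F : I -> R) :
  \sum_y (x == y)%:R * F y = F x.
Proof.
rewrite (bigD1 x) //= eqxx mul1r big1 ?addr0 // => y yx.
by rewrite eq_sym (negPf yx) mul0r.
Qed.

(** * Action of the walk on states induced by vertex functions *)

Section Walk.
Variables (R : realType) (V : finType) (e : rel V) (k : nat) (S : {set V}).
Hypotheses (sym_e : symmetric e) (reg_e : regular_graph e k).

Local Notation U := (transition R e k S).
Local Notation arc := (graph_arc e).

Definition reverse_arc (a : arc) : arc :=
  Sub ((val a).2, (val a).1) (etrans (sym_e _ _) (valP a)).

Lemma sum_arcs (x : V) (F : V -> R) :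
  \sum_(a : arc | arc_tail a == x) F (arc_head a) = \sum_(y | e x y) F y.
Proof.
rewrite /arc_tail /arc_head.
under eq_bigl => a do rewrite -[_ == x](andb_idr (fun _ => valP a)).
rewrite (@sum_val _ _ _ arc (fun p => (p.1 == x) && e p.1 p.2)
  (fun p => F p.2)) => [|p /andP[]//].
rewrite -(pair_big_dep (fun y => y == x) (fun y z => e y z) (fun y z => F z)) /=.
by rewrite big_pred1_eq.
Qed.

Lemma sum_degree (x : V) (c : R) : \sum_(y | e x y) c = k%:R * c.
Proof. by rewrite sumr_const -(reg_e x) mulr_natl. Qed.

Definition tail_state (f : V -> R) : 'cV[R]_#|arc| :=
  \col_j f (arc_tail (enum_val j)).

Definition head_state (f : V -> R) : 'cV[R]_#|arc| :=
  \col_j f (arc_head (enum_val j)).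

(** The value at [a] is the coin output at the reversed arc, whose tail is the head of [a]. The coin
    is the Grover reflection at an unmarked vertex and minus the identity at a marked one. *)
Lemma transition_entry (z : 'cV_#|arc|) a :
  (U *m z) (enum_rank a) 0 =
  (if arc_head a \in S then 0
   else 2 / k%:R * \sum_(b : arc | arc_tail b == arc_head a) z (enum_rank b) 0)
  - z (enum_rank (reverse_arc a)) 0.
Proof.
have DOD b :
  ((tail_incidence R e)^T *m unmarked_id R S *m tail_incidence R e *m z)
    (enum_rank b) 0 = if arc_tail b \in S then 0
    else \sum_(c : arc | arc_tail c == arc_tail b) z (enum_rank c) 0.
  rewrite -!mulmxA mulmx_enum_rank.
  under eq_bigr => x _ do rewrite {1}/entry mxE -/(entry _ _ _) entry_fmx eq_sym.
  rewrite sum_pred1_natr mulmx_enum_rank.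
  under eq_bigr => x _ do rewrite entry_fmx.
  case: ifPn => [bS|bS].
    by apply: big1 => x _; case: eqVneq => [<-|_]; rewrite ?bS ?if_same mul0r.
  rewrite sum_pred1_natr mulmx_enum_rank [RHS]big_mkcond; apply: eq_bigr => c _.
  by rewrite entry_fmx eq_sym; case: eqP; rewrite ?mul1r ?mul0r.
rewrite /transition -mulmxA mulmx_enum_rank.
under eq_bigr => b _ do rewrite entry_fmx.
rewrite (eq_bigr (fun b => (reverse_arc a == b)%:R * (((2 / k%:R) *:
    ((tail_incidence R e)^T *m unmarked_id R S *m tail_incidence R e) - 1%:M) *m z)
    (enum_rank b) 0)); last first.
  move=> b _; congr ((nat_of_bool _)%:R * _); case: b => -[x y] exy.
  by rewrite -val_eqE /arc_tail /arc_head /= xpair_eqE andbC.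
rewrite sum_pred1_natr mulmxBl mul1mx -scalemxAl.
move: (_ *m z) DOD => w DOD; rewrite !mxE DOD.
by case: ifP; rewrite ?mulr0.
Qed.

(** The Grover coin fixes states that are constant on the arcs leaving each vertex, and its sign
    change at marked vertices meets the value 0. Only the reversal remains. *)
Lemma transition_tail_state f : k != 0%N -> {in S, forall x, f x = 0} ->
  U *m tail_state f = head_state f.
Proof.
move=> k0 fS; apply/colP => j; rewrite -[j]enum_valK transition_entry.
rewrite !mxE enum_rankK.
under eq_bigr => b /eqP bt do rewrite mxE enum_rankK bt.
rewrite (sum_arcs _ (fun=> _)) sum_degree /= enum_rankK.
rewrite /arc_tail /= -/(arc_head _).
case: ifPn => [/fS->|_]; first by rewrite subr0.
have : k%:R != 0 :> R by rewrite pnatr_eq0.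
by move=> k0'; field.
Qed.

(** The coin sums [f] over the neighbours of the head, which the eigenvalue equation evaluates off
    [S]; at a marked head the coin sum is absent and [f] is 0. *)
Lemma transition_head_state f l :
    {in S, forall x, f x = 0} ->
    (forall x, x \notin S -> \sum_(y | e x y) f y = l * f x) ->
  U *m head_state f = (2 * (l / k%:R)) *: head_state f - tail_state f.
Proof.
move=> fS fl; apply/colP => j; rewrite -[j]enum_valK transition_entry.
rewrite !mxE enum_rankK; congr (_ - _); last by rewrite enum_rankK.
under eq_bigr => b _ do rewrite mxE enum_rankK.
rewrite sum_arcs enum_rankK.
case: ifPn => [/fS->|/fl->]; first by rewrite mulr0.
by rewrite -!mulrA [_^-1 * _]mulrCA.
Qed.

(** For the tail state T and head state H, U T = H and U H = 2 (l/k) H - T give U^2 T = 2 (l/k) U T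
    - T; then apply U^t. *)
Lemma oscillation_tail_state f l j : k != 0%N ->
    {in S, forall x, f x = 0} ->
    (forall x, x \notin S -> \sum_(y | e x y) f y = l * f x) ->
  oscillation (l / k%:R) (fun t => (U ^+ t *m tail_state f) j 0).
Proof.
move=> k0 fS fl t.
have := transition_tail_state k0 fS; have := transition_head_state fS fl.
move: U => W Whead Wtail; rewrite !exprSr -!mulmxE -!mulmxA Wtail Whead.
by rewrite mulmxBr -scalemxAr !mxE.
Qed.

(** Maximum principle: if |l| >= k, a vertex where |f| is maximal forces the same value on all its
    neighbours, and a path carries this to a marked vertex, where [f] is 0. *)
Lemma eigenvalue_lt_degree (f : V -> R) l :
    connected_graph e -> S != finset.set0 ->
    {in S, forall x, f x = 0} ->
    (forall x, x \notin S -> \sum_(y | e x y) f y = l * f x) ->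
    (exists x, f x != 0) ->
  `|l| < k%:R.
Proof.
move=> conn /set0Pn[s sS] fS fl [x0 fx0]; rewrite ltNge; apply/negP => kl.
pose m := `|f [arg max_(x > x0) `|f x|]%O|.
have maxm x : `|f x| <= m by rewrite /m; case: arg_maxP => // i _; apply.
have m0 : 0 < m by rewrite (lt_le_trans _ (maxm x0)) ?normr_gt0.
have step x y : `|f x| = m -> e x y -> `|f y| = m.
  move=> fx exy; have xS : x \notin S.
    by apply/negP => /fS fx0'; move: m0; rewrite -fx fx0' normr0 ltxx.
  (* The terms are nonnegative, and k m <= |l f(x)| <= sum of |f z| bounds the total by 0. *)
  have sum0 : \sum_(z | e x z) (m - `|f z|) = 0.
    apply/eqP; rewrite eq_le sumr_ge0 => [|z _]; last by rewrite subr_ge0.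
    rewrite andbT sumrB sum_degree subr_le0.
    apply: (le_trans (ler_wpM2r (ltW m0) kl)).
    by rewrite -fx -normrM -fl //; exact: ler_norm_sum.
  move/eqP: sum0; rewrite psumr_eq0 => [/allP/(_ y)|z _]; last by rewrite subr_ge0.
  by rewrite mem_index_enum exy subr_eq0 eq_sym => /(_ isT)/eqP.
have /connectP[p pth lastp] := conn [arg max_(x > x0) `|f x|]%O s.
suff : `|f s| = m by rewrite fS // normr0 => m0'; move: m0; rewrite -m0' ltxx.
have : `|f [arg max_(x > x0) `|f x|]%O| = m by [].
rewrite lastp; elim: p [arg max_(x > x0) `|f x|]%O pth {lastp} => //= y p IHp x.
by move=> /andP[exy pth] fx; apply: IHp (step _ _ fx exy).
Qed.

End Walk.

(** * Eigenprojections of the unmarked subgraph and the exact mixing formula *)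

Section Spectral.
Variables (R : realType) (V : finType) (e : rel V) (k : nat) (S : {set V}).
Hypotheses (sym_e : symmetric e) (reg_e : regular_graph e k).
Hypotheses (conn_e : connected_graph e) (S_neq0 : S != finset.set0).
Variables (d : nat) (lam : 'I_d -> R) (G : 'I_d -> 'M[R]_#|unmarked S|).
Hypothesis specG :
  spectral_decomposition (unmarked_block S (adjacency R e)) lam G.

Local Notation XS := (delete e (S := S)).
Local Notation g := (fun r u v => entry (G r) u v).

Lemma adjacency_block (u v : unmarked S) :
  entry (unmarked_block S (adjacency R e)) u v = (XS u v)%:R.
Proof. by rewrite !entry_fmx. Qed.

Lemma sum_projection u v : \sum_r g r u v = (u == v)%:R.
Proof.
have [_ _ _ /matrixP/(_ (enum_rank u) (enum_rank v)) + _] := specG.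
by rewrite summxE mxE (inj_eq enum_rank_inj).
Qed.

Lemma sum_eigenvalue_projection u v : \sum_r lam r * g r u v = (XS u v)%:R.
Proof.
have [_ _ _ _ AE] := specG; rewrite -adjacency_block AE /entry summxE.
by apply: eq_bigr => r _; rewrite mxE.
Qed.

Lemma sum_neighbours_projection r u v :
  \sum_(w | XS u w) g r w v = lam r * g r u v.
Proof.
have [_ _ /(_ r)[Gt _ GE] _ _] := specG.
have : (G r <= eigenspace (unmarked_block S (adjacency R e)) (lam r))%MS.
  by rewrite GE.
(* [eigenspace] consists of row vectors; transposing and using the symmetry of [G r] and of the
   graph moves the equation to columns. *)
move=> /eigenspaceP/(congr1 trmx); rewrite trmx_mul linearZ /= Gt => /matrixP.
move=> /(_ (enum_rank u) (enum_rank v)); rewrite mulmx_enum_rank mxE => <-.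
rewrite big_mkcond; apply: eq_bigr => w _.
rewrite {2}/entry mxE -/(entry _ _ _) adjacency_block /delete sym_e.
by case: ifP; rewrite ?mul1r ?mul0r.
Qed.

Definition zero_extension (f : unmarked S -> R) (x : V) : R :=
  if insub x is Some u then f u else 0.

Lemma zero_extension_val f u : zero_extension f (val u) = f u.
Proof. by rewrite /zero_extension valK. Qed.

Lemma zero_extension_marked f : {in S, forall x, zero_extension f x = 0}.
Proof. by move=> x xS; rewrite /zero_extension insubN // xS. Qed.

Lemma sum_zero_extension (h : V -> R) (u : unmarked S) :
    {in S, forall x, h x = 0} ->
  \sum_(y | e (val u) y) h y = \sum_(w | XS u w) h (val w).
Proof.
move=> hS.
rewrite (bigID (fun y => y \in S)) /= big1 => [|y /andP[_ /hS]//].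
rewrite add0r -(@sum_val _ _ _ (unmarked S)); last by move=> y /andP[].
by apply: eq_bigl => w; rewrite (valP w) andbT.
Qed.

Lemma zero_extension_projection r v x : x \notin S ->
  \sum_(y | e x y) zero_extension (g r ^~ v) y =
    lam r * zero_extension (g r ^~ v) x.
Proof.
move=> xS; pose u : unmarked S := Sub x xS.
rewrite -[x](SubK (unmarked S) xS) -/u sum_zero_extension.
  2: exact: zero_extension_marked.
under eq_bigr => w _ do rewrite zero_extension_val.
by rewrite sum_neighbours_projection zero_extension_val.
Qed.

Lemma eigenvalue_bound r : `|lam r| < k%:R.
Proof.
have [_ /(_ r)/eigenvalueP[w wE w0] _ _ _] := specG.
have [j wj] : exists j, w 0 j != 0.
  apply/existsP; apply: contra_neqT w0; rewrite negb_exists => /forallP w0.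
  by apply/rowP => j; rewrite mxE; apply/eqP; rewrite -[_ == _]negbK w0.
pose f := zero_extension (fun u => w 0 (enum_rank u)).
apply: (eigenvalue_lt_degree reg_e (f := f)) conn_e S_neq0 _ _ _ => [|x xS|].
- exact: zero_extension_marked.
- pose u : unmarked S := Sub x xS.
  rewrite -[x](SubK (unmarked S) xS) -/u sum_zero_extension.
    2: exact: zero_extension_marked.
  rewrite /f; under eq_bigr => y _ do rewrite zero_extension_val.
  rewrite zero_extension_val.
  move/rowP: wE => /(_ (enum_rank u)); rewrite !mxE sum_enum_rank => <-.
  rewrite big_mkcond; apply: eq_bigr => y _.
  rewrite -/(entry _ y u) adjacency_block /delete sym_e.
  by case: ifP; rewrite ?mulr1 ?mulr0.
- by exists (val (enum_val j)); rewrite /f zero_extension_val enum_valK.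
Qed.

Lemma sqr_eigenvalue_lt r : lam r ^+ 2 < k%:R ^+ 2.
Proof.
by rewrite -[lam r ^+ 2](real_normK (num_real _)) ltrXn2r //= eigenvalue_bound.
Qed.

(** If k = 0, the eigenvalue bound leaves no index [r], yet the projections sum to the identity,
    whose diagonal entry at [u] is 1. *)
Lemma degree_neq0 (u : unmarked S) : k != 0%N.
Proof.
apply/negP => /eqP k0; have := sum_projection u u; rewrite eqxx big1 => [/eqP|r _].
  by rewrite eq_sym oner_eq0.
by have := eigenvalue_bound r; rewrite k0 ltNge normr_ge0.
Qed.

Lemma initial_stateE (v : V) :
  initial_state R e k v =
    (Num.sqrt k%:R)^-1 *: tail_state e (fun x => (x == v)%:R).
Proof.
congr (_ *: _); apply/colP => j; rewrite -[j]enum_valK mulmx_enum_rank.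
rewrite (bigD1 v) //= big1 => [|y yv]; last first.
  by rewrite !mxE (inj_eq enum_rank_inj) (negPf yv) mulr0.
by rewrite /entry !mxE !eqxx mulr1 addr0 !enum_rankK eq_sym.
Qed.

(** The indicator of [v] is the sum over [r] of the columns [v] of the [G r], each of which evolves
    separately. *)
Lemma amplitudeE t (v : unmarked S) a :
  amplitude R k S t (val v) a = (Num.sqrt k%:R)^-1 *
    \sum_r (transition R e k S ^+ t *m tail_state e (zero_extension (g r ^~ v)))
             (enum_rank a) 0.
Proof.
rewrite /amplitude initial_stateE -scalemxAr mxE -summxE -mulmx_sumr.
congr (_ * fun_of_matrix (_ *m _) _ _).
apply/colP => j; rewrite summxE mxE.
under eq_bigr => r _ do rewrite mxE.
set x := arc_tail _; case: (boolP (x \in S)) => [xS|xS].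
  rewrite big1 => [|r _]; last exact: zero_extension_marked.
  by case: eqVneq => // xv; move: (valP v); rewrite -xv xS.
pose u : unmarked S := Sub x xS; rewrite -[x](SubK (unmarked S) xS) -/u.
under eq_bigr => r _ do rewrite zero_extension_val.
by rewrite sum_projection val_eqE.
Qed.

Lemma avg_mixing_block (u v : unmarked S) :
  entry (unmarked_block S (avg_mixing R e k S)) u v =
  \sum_r (2 * (k%:R ^+ 2 - lam r ^+ 2))^-1 *
    (k%:R * (\sum_(w | XS u w) g r w v ^+ 2)
     + (k%:R ^+ 2 - 2 * lam r ^+ 2) * g r u v ^+ 2).
Proof.
have k0 := degree_neq0 u.
have kR0 : k%:R != 0 :> R by rewrite pnatr_eq0.
have injc : injective (fun r => lam r / k%:R).
  by have [injl _ _ _ _] := specG => r q /mulIf;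
    rewrite invr_eq0 => /(_ kR0)/injl.
have c1 r : (lam r / k%:R) ^+ 2 < 1.
  rewrite expr_div_n ltr_pdivrMr ?mul1r ?sqr_eigenvalue_lt //.
  by rewrite exprn_gt0 // ltr0n lt0n.
pose f r := zero_extension (g r ^~ v).
have mean := @mean_to_sum R _ (index_enum _)
  (fun a : graph_arc e => arc_tail a == val u)
  (fun a t => `|amplitude R k S t (val v) a| ^+ 2)
  (fun a => k%:R^-1 * \sum_r
     energy (lam r / k%:R) (f r (arc_tail a)) (f r (arc_head a))
     / (2 * (1 - (lam r / k%:R) ^+ 2))).
rewrite !entry_fmx; apply: etrans (cvg_lim _ (mean _)) _ => //.
  move=> a _.
  under eq_fun => t do rewrite real_normK ?num_real // amplitudeE exprMn
    exprVn sqr_sqrtr //.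
  apply: mean_toZ.
  (* The energies depend on the values at times 0 and 1, which are those of the tail and head
     states. *)
  have := mean_sum_oscillation_sqr injc c1 (fun r =>
    oscillation_tail_state sym_e reg_e (enum_rank a) k0
      (@zero_extension_marked (g r ^~ v)) (@zero_extension_projection r v)).
  rewrite /=; under eq_bigr => r _.
    rewrite expr0 mul1mx expr1 (transition_tail_state sym_e reg_e k0);
      last exact: zero_extension_marked.
    rewrite !mxE enum_rankK; over.
  by [].
rewrite -mulr_sumr exchange_big mulr_sumr; apply: eq_bigr => r _ /=.
have fE w : f r (val w) = g r w v by exact: zero_extension_val.
(* The arcs leaving [u] contribute k equal squares, the squares over the neighbours, and a cross
   term in which the neighbour sum is [lam r * g r u v]. *)
have sumE : \sum_(a : graph_arc e | arc_tail a == val u)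
      energy (lam r / k%:R) (f r (arc_tail a)) (f r (arc_head a)) =
    k%:R * g r u v ^+ 2 + \sum_(w | XS u w) g r w v ^+ 2
    - 2 * (lam r / k%:R) * g r u v * (lam r * g r u v).
  under eq_bigr => a /eqP au do rewrite au.
  rewrite (@sum_arcs R V e _ (fun y => energy _ (f r (val u)) (f r y))).
  rewrite /energy !big_split /= sumrN (sum_degree reg_e) -[X in _ - X]mulr_sumr.
  rewrite (zero_extension_projection r v (valP u)) -/(f r).
  rewrite (sum_zero_extension (h := fun y => f r y ^+ 2)); last first.
    by move=> y yS /=; rewrite /f zero_extension_marked ?expr0n.
  rewrite (eq_bigr (fun w => g r w v ^+ 2)) => [|w _]; last by rewrite fE.
  by rewrite [f r (sval u)]fE.
have kl : k%:R ^+ 2 - lam r ^+ 2 != 0.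
  by rewrite gt_eqF // subr_gt0 sqr_eigenvalue_lt.
rewrite -mulr_suml sumE; set s := \sum_(w | _) _; set x := g r u v.
by field; rewrite kR0 kl.
Qed.

End Spectral.

(** * Components of graphs of maximum degree at most one *)

Section Matching.
Variables (W : finType) (f : rel W).
Hypothesis sym_f : symmetric f.
Hypothesis deg_f : forall x, (vdegree f x <= 1)%N.

Lemma neighbour_unique x y z : f x y -> f x z -> y = z.
Proof. by move=> fy fz; apply: (card_le1_eqP (deg_f x)); rewrite inE. Qed.

(** Each of the two endpoints has the other as its only neighbour, so the pair is closed under
    adjacency. *)
Lemma graph_component_edge x y : f x y ->
  graph_component f x = [set x; y]%SET.
Proof.
move=> fxy; apply/setP => z; rewrite !inE; apply/idP/idP.
  have fyx : f y x by rewrite sym_f.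
  have clo : fingraph.closed f [set x; y]%SET.
    apply: (intro_closed (sym_connect_sym sym_f)) => a b fab.
    rewrite !inE => /orP[]/eqP ax; rewrite ax in fab.
      by rewrite (neighbour_unique fab fxy) eqxx orbT.
    by rewrite (neighbour_unique fab fyx) eqxx.
  by move=> /(closed_connect clo); rewrite !inE eqxx => <-.
by case/orP => /eqP->; [exact: connect0|exact: connect1].
Qed.

Lemma edge_component_edge x y : f x y -> edge_component f (graph_component f x).
Proof. by move=> fxy; exists x, y; split=> //; exact: graph_component_edge. Qed.

End Matching.

Section EdgeComponents.
Variables (W : finType) (f : rel W).
Hypotheses (sym_f : symmetric f) (irr_f : irreflexive f).

Lemma mem_graph_component x : x \in graph_component f x.
Proof. by rewrite inE connect0. Qed.

Lemma edge_componentP x : edge_component f (graph_component f x) ->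
  exists2 y, f x y & graph_component f x = [set x; y]%SET.
Proof.
case=> a [b [fab _ Cab]]; have := mem_graph_component x.
rewrite Cab !inE => /orP[]/eqP->; first by exists b.
by exists a; [rewrite sym_f|rewrite finset.setUC].
Qed.

(** Turns the description by components into the local degree condition to which the equality case
    is reduced. *)
Lemma union_of_edges_degree :
  union_of_edges_and_isolated f <-> forall x, (vdegree f x <= 1)%N.
Proof.
split=> [un x|deg x].
  case: (un x) => [/edge_componentP[y fxy Cx]|->] //.
  apply/card_le1_eqP; suff E z : f x z -> z = y.
    by move=> a b; rewrite !inE => /E-> /E->.
  move=> fxz; have : z \in graph_component f x by rewrite inE connect1.
  by rewrite Cx !inE => /orP[]/eqP // zx; move: fxz; rewrite zx irr_f.
case: (posnP (vdegree f x)) => [|/card_gt0P[y]]; first by right.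
by rewrite inE => fxy; left; apply: (edge_component_edge sym_f deg fxy).
Qed.

(** The neighbour [w] rules out the case of an isolated [u = v]. *)
Lemma same_edge_componentP u v : (forall x, (vdegree f x <= 1)%N) ->
  same_edge_component f u v <-> (exists w, f u w) /\ (u == v) || f u v.
Proof.
move=> deg; split.
  case=> /edge_componentP[w fuw Cu] Cuv; split; first by exists w.
  have := mem_graph_component v; rewrite -Cuv Cu !inE eq_sym.
  by case: eqP => //= _ /eqP->.
case=> -[w fuw] uv; split; first exact: edge_component_edge fuw.
case/orP: uv => [/eqP->//|fuv].
rewrite (graph_component_edge sym_f deg fuv).
rewrite sym_f in fuv.
by rewrite (graph_component_edge sym_f deg fuv) finset.setUC.
Qed.

End EdgeComponents.

(** * Pseudo-inverse of a diagonal matrix *)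

Section DiagonalMatrix.
Variable R : realType.

Lemma mulmx_fmx (I J K : finType) (p : I -> J -> R) (q : J -> K -> R) :
  fmx p *m fmx q = fmx (fun x z => \sum_y p x y * q y z).
Proof.
apply/matrixP => i j; rewrite !mxE sum_enum_rank.
by apply: eq_bigr => y _; rewrite !mxE enum_rankK.
Qed.

Lemma mulmx_diag (I J : finType) (p q : I -> R) :
  fmx (fun x y : I => if x == y then p x else 0) *m
  fmx (fun x y : I => if x == y then q x else 0) =
  fmx (fun x y : I => if x == y then p x * q x else 0).
Proof.
rewrite mulmx_fmx; congr fmx; apply/funext => x; apply/funext => y.
rewrite (bigD1 x) //= eqxx big1 ?addr0; first by case: eqP; rewrite ?mulr0.
by move=> z zx; rewrite eq_sym (negPf zx) mul0r.
Qed.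

Lemma trmx_diag (I : finType) (p : I -> R) :
  (fmx (fun x y : I => if x == y then p x else 0))^T =
  fmx (fun x y : I => if x == y then p x else 0).
Proof. by apply/matrixP => i j; rewrite !mxE eq_sym; case: eqP => // ->. Qed.

(** Since [0^-1 = 0], the entrywise inverse satisfies the Penrose equations even at zero diagonal
    entries; uniqueness concludes. *)
Lemma pinv_diag (I : finType) (p : I -> R) :
  Defs.pinv (fmx (fun x y : I => if x == y then p x else 0)) =
  fmx (fun x y : I => if x == y then (p x)^-1 else 0).
Proof.
apply: moore_penrose_unique (Defs.pinvP _) _.
have E (x : R) : x * x^-1 * x = x.
  by have [->|x0] := eqVneq x 0; rewrite ?mulr0 // divfK.
split; rewrite !mulmx_diag ?trmx_diag //; congr fmx;
  apply/funext => x; apply/funext => y; case: ifP => // _; rewrite ?E //.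
by rewrite -[X in _ * X * _]invrK E.
Qed.

End DiagonalMatrix.

(** * The lower bound and its equality case *)

Section LowerBound.
Variables (R : realType) (V : finType) (e : rel V) (k : nat) (S : {set V}).
Hypotheses (sym_e : symmetric e) (reg_e : regular_graph e k).
Hypotheses (conn_e : connected_graph e) (S_neq0 : S != finset.set0).
Variables (d : nat) (lam : 'I_d -> R) (G : 'I_d -> 'M[R]_#|unmarked S|).
Hypothesis specG :
  spectral_decomposition (unmarked_block S (adjacency R e)) lam G.

Local Notation XS := (delete e (S := S)).
Local Notation g := (fun r u v => entry (G r) u v).
Local Notation M := (unmarked_block S (avg_mixing R e k S)).
Local Notation B := (lower_bound e k lam G).

Lemma lower_bound_entry (u v : unmarked S) :
  entry B u v = \sum_r (2 * (k%:R ^+ 2 - lam r ^+ 2))^-1 *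
    (((k%:R ^+ 2 - 2 * lam r ^+ 2) + k%:R * lam r ^+ 2 * (vdegree XS u)%:R^-1)
      * g r u v ^+ 2).
Proof.
rewrite /lower_bound /degree_matrix pinv_diag /entry mxE summxE mulr_sumr.
apply: eq_bigr => r _; rewrite mxE mulmx_enum_rank.
rewrite (eq_bigr (fun y => (u == y)%:R * (((k%:R ^+ 2 - 2 * lam r ^+ 2)
   + k%:R * lam r ^+ 2 * (vdegree XS u)%:R^-1) * g r y v ^+ 2))); last first.
  move=> y _; rewrite /entry !mxE (inj_eq enum_rank_inj) !enum_rankK -expr2.
  by case: eqP => [<-|_]; rewrite ?mulr1 ?mul1r ?mulr0 ?addr0 ?mul0r.
by rewrite sum_pred1_natr !mul1r mulrA -invfM.
Qed.

(** The subtracted constant is the mean of [g r w v] over the neighbours [w] of [u], so this is the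
    usual expansion of a variance. *)
Lemma sum_neighbour_variance r (u v : unmarked S) :
  \sum_(w | XS u w) (g r w v - lam r * g r u v / (vdegree XS u)%:R) ^+ 2 =
  \sum_(w | XS u w) g r w v ^+ 2
  - lam r ^+ 2 * (vdegree XS u)%:R^-1 * g r u v ^+ 2.
Proof.
set m := lam r * _ / _; under eq_bigr => w _ do rewrite sqrrB.
rewrite big_split /= sumrB sumr_const -[#|_|]/(vdegree XS u).
under [X in _ - X + _]eq_bigr => w _ do rewrite -mulrnAr.
rewrite -mulr_suml (sum_neighbours_projection sym_e specG).
(* Without neighbours, [0^-1 = 0] makes the correction terms vanish. *)
rewrite /m; case: (eqVneq (vdegree XS u) 0%N) => [->|n0].
  by rewrite invr0 !(mulr0, mul0r, mulr0n, mul0rn) !addr0 subr0.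
have n0' : (vdegree XS u)%:R != 0 :> R by rewrite pnatr_eq0.
by rewrite -mulr_natr; field.
Qed.

Lemma mixing_gap (u v : unmarked S) :
  entry M u v - entry B u v = \sum_r k%:R / (2 * (k%:R ^+ 2 - lam r ^+ 2)) *
    \sum_(w | XS u w) (g r w v - lam r * g r u v / (vdegree XS u)%:R) ^+ 2.
Proof.
rewrite (avg_mixing_block sym_e reg_e conn_e S_neq0 specG).
rewrite lower_bound_entry -sumrB.
by apply: eq_bigr => r _; rewrite sum_neighbour_variance; ring.
Qed.

Lemma mixing_gap_coef_gt0 r (u : unmarked S) :
  0 < k%:R / (2 * (k%:R ^+ 2 - lam r ^+ 2)).
Proof.
have k0 := degree_neq0 sym_e reg_e conn_e S_neq0 specG u.
rewrite divr_gt0 ?ltr0n ?lt0n // mulr_gt0 // subr_gt0.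
exact: (sqr_eigenvalue_lt sym_e reg_e conn_e S_neq0 specG).
Qed.

Lemma avg_mixing_ge_lower_bound (u v : unmarked S) : entry B u v <= entry M u v.
Proof.
rewrite -subr_ge0 mixing_gap sumr_ge0 // => r _.
rewrite mulr_ge0 ?sumr_ge0 // ?ltW ?(mixing_gap_coef_gt0 r u) // => w _.
exact: sqr_ge0.
Qed.

Lemma mixing_eq_degree : M = B <-> forall u, (vdegree XS u <= 1)%N.
Proof.
split=> [MB u|deg].
  (* A zero gap with positive coefficients kills every variance, so each neighbour takes the mean
     value, which is independent of [w]. *)
  have gw v r w : XS u w -> g r w v = lam r * g r u v / (vdegree XS u)%:R.
    move=> uw; have := mixing_gap u v; rewrite MB subrr => /esym/eqP.
    rewrite psumr_eq0 => [/allP/(_ r (mem_index_enum _))|q _]; last first.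
      rewrite mulr_ge0 ?sumr_ge0 // ?ltW ?(mixing_gap_coef_gt0 q u) // => x _.
      exact: sqr_ge0.
    rewrite mulf_eq0 gt_eqF ?(mixing_gap_coef_gt0 r u) //= psumr_eq0 => [|x _].
      2: exact: sqr_ge0.
    move=> /allP/(_ w (mem_index_enum _)).
    by rewrite uw sqrf_eq0 subr_eq0 => /eqP.
  apply/card_le1_eqP => w w'; rewrite !inE => uw uw'; apply/eqP.
  have : (w == w)%:R = (w' == w)%:R :> R.
    rewrite -(sum_projection specG w w) -(sum_projection specG w' w).
    by apply: eq_bigr => r _; rewrite (gw _ _ _ uw) (gw _ _ _ uw').
  by rewrite eqxx eq_sym; case: eqP => // _ /eqP; rewrite oner_eq0.
apply/matrixP => i j; rewrite -[i]enum_valK -[j]enum_valK.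
set u := enum_val i; set v := enum_val j; apply/eqP; rewrite -subr_eq0.
rewrite -/(entry M u v) -/(entry B u v) mixing_gap big1 // => r _.
rewrite big1 ?mulr0 // => w uw.
(* With a single neighbour, the mean is the value there and the variance is 0. *)
have dE : vdegree XS u = 1%N.
  by apply/eqP; rewrite eqn_leq deg; apply/card_gt0P; exists w.
rewrite dE divr1 -(sum_neighbours_projection sym_e specG) (bigD1 w) //=.
rewrite big1 ?addr0 ?subrr ?expr0n //.
by move=> x /andP[ux]; rewrite (neighbour_unique deg ux uw) eqxx.
Qed.

End LowerBound.

(** * Mixing values on isolated vertices and edges *)

Section Values.
Variables (R : realType) (V : finType) (e : rel V) (k : nat) (S : {set V}).
Hypotheses (sym_e : symmetric e) (reg_e : regular_graph e k).
Hypotheses (conn_e : connected_graph e) (S_neq0 : S != finset.set0).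
Variables (d : nat) (lam : 'I_d -> R) (G : 'I_d -> 'M[R]_#|unmarked S|).
Hypothesis specG :
  spectral_decomposition (unmarked_block S (adjacency R e)) lam G.

Local Notation XS := (delete e (S := S)).
Local Notation g := (fun r u v => entry (G r) u v).
Local Notation M := (unmarked_block S (avg_mixing R e k S)).

(** The empty neighbour sum gives [lam r * g r u v = 0], so only the eigenvalue 0 can contribute,
    with coefficient k^2 / (2 k^2). *)
Lemma mixing_isolated (u v : unmarked S) : isolated_vertex XS u ->
  entry M u v = 2^-1 * (u == v)%:R.
Proof.
move=> iso_u; have k0 := degree_neq0 sym_e reg_e conn_e S_neq0 specG u.
have no_nbr w : XS u w = false by apply: (card0_eq iso_u).
have injl : injective lam by case: specG.
have lg r : lam r * g r u v = 0.
  by rewrite -(sum_neighbours_projection sym_e specG) big_pred0.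
have g2 r : g r u v ^+ 2 = g r u v * (u == v)%:R.
  have /eqP := lg r; rewrite mulf_eq0 => /orP[/eqP l0|/eqP->].
    2: by rewrite expr0n mul0r.
  rewrite -(sum_projection specG) (bigD1 r) //= big1 ?addr0 // => q qr.
  have /eqP := lg q; rewrite mulf_eq0 => /orP[|/eqP//].
  by rewrite -l0 (inj_eq injl) (negPf qr).
rewrite (avg_mixing_block sym_e reg_e conn_e S_neq0 specG).
rewrite (eq_bigr (fun r => 2^-1 * (g r u v * (u == v)%:R))) => [|r _].
  rewrite -mulr_sumr -mulr_suml (sum_projection specG).
  by case: eqP; rewrite ?mulr1 ?mulr0.
rewrite big_pred0 // mulr0 add0r -g2.
have /eqP := lg r; rewrite mulf_eq0 => /orP[/eqP->|/eqP->].
  2: by rewrite expr0n !mulr0.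
have kR0 : k%:R != 0 :> R by rewrite pnatr_eq0.
by field; rewrite kR0.
Qed.

Lemma mixing_edge (u w v : unmarked S) : (forall x, (vdegree XS x <= 1)%N) ->
  XS u w ->
  entry M u v = (k%:R + 2) / (4 * (k%:R + 1)) * ((u == v)%:R + (XS u v)%:R).
Proof.
move=> deg uw; have injl : injective lam by case: specG.
have wu : XS w u by rewrite /delete sym_e.
have gE a b r : XS a b -> g r b v = lam r * g r a v.
  move=> ab; rewrite -(sum_neighbours_projection sym_e specG) (bigD1 b) //=.
  rewrite big1 ?addr0 // => x /andP[ax].
  by rewrite (neighbour_unique deg ax ab) eqxx.
have l2g r : lam r ^+ 2 * g r u v = g r u v.
  by rewrite expr2 -mulrA -(gE _ _ r uw) -(gE _ _ r wu).
have lg r : (lam r == 1) || (lam r == -1) || (g r u v == 0).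
  rewrite -eqf_sqr expr1n -subr_eq0 -mulf_eq0 mulrBl l2g mul1r subrr //.
(* Where nonzero, [g r u v] is half of [(u == v) + lam r * XS u v], an entry of the projection onto
   an eigenvector of an edge. Keeping one factor [g r u v] gives an expression whose sum over [r] is
   known, whichever eigenvalues occur. *)
have g2 r : g r u v ^+ 2 =
    2^-1 * (g r u v * (u == v)%:R + lam r * g r u v * (XS u v)%:R).
  have [->|g0] := eqVneq (g r u v) 0.
    by rewrite expr0n /= !(mulr0, mul0r, addr0).
  (* The terms q != r vanish, as lam q = - lam r or G_q u v = 0. *)
  have : 2 * g r u v = (u == v)%:R + lam r * (XS u v)%:R.
    rewrite -(sum_projection specG) -(sum_eigenvalue_projection specG).
    rewrite mulr_sumr -big_split.
    rewrite (bigD1 r) //= big1 ?addr0 => [|q qr].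
      by rewrite mulrA -expr2 l2g mulr_natl mulr2n.
    have := lg r; rewrite (negPf g0) orbF => lr.
    have /orP[lq|/eqP->] := lg q; last by rewrite !mulr0 addr0.
    suff -> : lam q = - lam r.
      rewrite mulNr mulrN mulrA -expr2; case/orP: lr => /eqP->;
        by rewrite ?sqrrN expr1n mul1r subrr.
    have : lam q != lam r by rewrite (inj_eq injl).
    case/orP: lr => /eqP->; case/orP: lq => /eqP->; rewrite ?eqxx ?opprK //.
  move=> E; apply: (@mulfI _ 2); rewrite ?pnatr_eq0 // mulVKf ?pnatr_eq0 //.
  by rewrite expr2 mulrA E; ring.
rewrite (avg_mixing_block sym_e reg_e conn_e S_neq0 specG).
(* With [lam r ^+ 2 = 1] the coefficient is (k + k^2 - 2) / (2 (k^2 - 1)), and the factor k - 1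
   cancels. *)
rewrite (eq_bigr (fun r => (k%:R + 2) / (2 * (k%:R + 1)) * g r u v ^+ 2)) => [|r _].
  rewrite -mulr_sumr; under eq_bigr => r _ do rewrite g2.
  rewrite -mulr_sumr big_split /= -!mulr_suml (sum_projection specG).
  rewrite (sum_eigenvalue_projection specG) -!natrM !mulnb !andbb.
  rewrite mulrA; congr (_ * _).
  have k1 : k%:R + 1 != 0 :> R by rewrite natr1 pnatr_eq0.
  by field.
have -> : \sum_(x | XS u x) g r x v ^+ 2 = g r u v ^+ 2.
  rewrite (bigD1 w) //= big1 ?addr0 => [|x /andP[ux]]; last first.
    by rewrite (neighbour_unique deg ux uw) eqxx.
  by rewrite (gE _ _ r uw) exprMn [_ ^+ 2 in X in _ * X]expr2 mulrA l2g expr2.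
have [->|g0] := eqVneq (g r u v) 0; first by rewrite expr0n !mulr0 addr0 mulr0.
have l1 : lam r ^+ 2 = 1.
  by apply: (mulIf g0); rewrite l2g mul1r.
have := sqr_eigenvalue_lt sym_e reg_e conn_e S_neq0 specG r; rewrite l1 => k1.
have k1' : k%:R + 1 != 0 :> R by rewrite natr1 pnatr_eq0.
have k1'' : k%:R ^+ 2 - 1 != 0 :> R by rewrite gt_eqF // subr_gt0.
by field; rewrite k1' k1''.
Qed.

End Values.

Theorem theorem9p1 (R : realType) (V : finType) (e : rel V) (k : nat)
    (S : {set V}) (d : nat) (lam : 'I_d -> R)
    (G : 'I_d -> 'M[R]_#|unmarked S|) :
  simple_graph e ->
  connected_graph e ->
  regular_graph e k ->
  S != finset.set0 ->
  spectral_decomposition (unmarked_block S (adjacency R e)) lam G ->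
  let M := unmarked_block S (avg_mixing R e k S) in
  let B := lower_bound e k lam G in
  let XS := delete e (S := S) in
  [/\ forall u v : unmarked S, entry B u v <= entry M u v,
      M = B <-> union_of_edges_and_isolated XS
    & union_of_edges_and_isolated XS ->
      forall u v : unmarked S,
      [/\ same_edge_component XS u v ->
            entry M u v = (k%:R + 2) / (4 * (k%:R + 1)),
          u = v -> isolated_vertex XS u -> entry M u v = 1 / 2
        & ~ same_edge_component XS u v -> ~ (u = v /\ isolated_vertex XS u) ->
            entry M u v = 0] ].
Proof.
move=> [sym_e irr_e] conn_e reg_e S0 specG M B XS.
have sym_XS : symmetric XS by move=> x y; exact: sym_e.
have irr_XS : irreflexive XS by move=> x; exact: irr_e.
have unionP := union_of_edges_degree sym_XS irr_XS.
have isoE := mixing_isolated sym_e reg_e conn_e S0 specG.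
split=> [u v||/unionP deg u v].
- exact (avg_mixing_ge_lower_bound sym_e reg_e conn_e S0 specG u v).
- exact: iff_trans (mixing_eq_degree sym_e reg_e conn_e S0 specG) (iff_sym unionP).
have edgeE := mixing_edge sym_e reg_e conn_e S0 specG _ deg.
have sameP := same_edge_componentP sym_XS u v deg.
split=> [/sameP[[w uw] uv]|<- iso_u|nsame niso].
(* By irreflexivity, exactly one of the two indicators in the edge formula is 1. *)
- rewrite /M (edgeE _ _ _ uw); case: eqVneq uv => [<- _|_ /= uv].
    by rewrite [delete e _ _]irr_XS addr0 mulr1.
  by rewrite [delete e _ _]uv add0r mulr1.
- by rewrite /M isoE // eqxx mulr1 mul1r.
case: (posnP (vdegree XS u)) => [iso_u|/card_gt0P[w]].
  by rewrite /M isoE //; case: eqP => [uv|]; [case: niso|rewrite mulr0].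
rewrite inE => uw; rewrite /M (edgeE _ _ _ uw).
have : ~~ ((u == v) || XS u v).
  by apply/negP => uv; apply/nsame/sameP; split=> //; exists w.
rewrite negb_or => /andP[/negPf-> /negPf nuv].
by rewrite [delete e _ _]nuv addr0 mulr0.
Qed.
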